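(* Let $K$ be a field and let $G$ be a finite simple graph without isolated vertices. Then $\operatorname{reg} I(X_G)\geq \mu(G)$, where $\mu(G)$ is the maximum vertex join number of $G$.
   Context: Graphs have nonempty vertex set. For a graph $G$ with vertex set $V_G$ and edge set $E_G$, let $K[V_G]=K[x_i: i\in V_G]$ and $K[E_G]=K[t_e: e\in E_G]$ be standard graded polynomial rings, and let $\theta\colon K[E_G]\to K[V_G]$ be the $K$-algebra homomorphism with $\theta(t_e)=x_ix_j$ for each edge $e=\{i,j\}$. The ideal $I(X_G)\subseteq K[E_G]$ is the (homogeneous) ideal $I(X_G)=\theta^{-1}\big((x_i^2-x_j^2 : i,j\in V_G)\big)$. The Castelnuovo--Mumford regularity of a finitely generated graded module $M$ over a polynomial ring is $\operatorname{reg} M=\max\{j-i : \beta_{ij}\neq 0\}$, where $\beta_{ij}$ are the graded Betti numbers of $M$; for ideals, $\operatorname{reg} I(X_G)=\operatorname{reg} K[E_G]/I(X_G)+1$ (in particular $\operatorname{reg} I(X_G)=1$ when $I(X_G)=(0)$). A circuit is a closed trail (edges are not repeated, vertices may be), with edge set $E_C$. A join of $G$ is a set $J\subseteq E_G$ such that $|J\cap E_C|\leq |E_C|/2$ for every circuit $C$ in $G$. The maximum vertex join number $\mu(G)$ is the maximum cardinality of a join of $G$. *)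

(* Defs.v *)
From HB Require Import structures.
From mathcomp Require Import all_boot all_order all_algebra.
From mathcomp Require Import boolp.
From mathcomp Require Import mpoly.

Set Implicit Arguments.
Unset Strict Implicit.
Unset Printing Implicit Defensive.

Import Order.TTheory GRing.Theory Num.Theory.
Local Open Scope ring_scope.

(** * Graded Betti numbers and regularity of a quotient of a polynomial ring *)

(* Ideals are given by their membership predicate. *)
Definition generated_by (T : finType) (R : comNzRingType) (g : T -> R) (f : R)
    : Prop :=
  exists c : T -> R, f = \sum_t c t * g t.

(* The data of a complex  ... -> F_2 -> F_1 -> F_0 -> S  of finitely generated
   graded free modules over S = K[x_0, ..., x_(n-1)], where F_i has a basis
   indexed by 'I_(fr_rank F i), the a-th basis element having degree
   fr_deg F i a.  Elements of F_i are row vectors, on which the maps act by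
   right multiplication.  A resolution of finite length has fr_rank F i = 0
   for i large. *)
Record free_complex (K : fieldType) (n : nat) := FreeComplex {
  fr_rank : nat -> nat;
  fr_deg  : forall i, 'I_(fr_rank i) -> nat;
  fr_diff : forall i, 'M[{mpoly K[n]}]_(fr_rank i.+1, fr_rank i);
  fr_aug  : 'cV[{mpoly K[n]}]_(fr_rank 0)
}.

(* A is homogeneous of degree 0 as a map  (+)_a S(- d a) -> (+)_b S(- d' b):
   the entry A a b is homogeneous of degree d a - d' b, hence zero when this
   number is negative. *)
Definition graded_mx (K : fieldType) (n p q : nat)
    (d : 'I_p -> nat) (d' : 'I_q -> nat) (A : 'M[{mpoly K[n]}]_(p, q)) : Prop :=
  forall a b m, m \in msupp (A a b) -> (mdeg m + d' b)%N = d a.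

(* F is a minimal graded free resolution of S/I; in the minimality clause,
   a zero constant coefficient means membership in the irrelevant ideal. *)
Record minimal_free_resolution (K : fieldType) (n : nat)
    (I : {mpoly K[n]} -> Prop) (F : free_complex K n) : Prop := {
  mfr_diff_graded : forall i, graded_mx (@fr_deg _ _ F i.+1) (@fr_deg _ _ F i)
                                        (fr_diff F i);
  mfr_aug_graded  : graded_mx (@fr_deg _ _ F 0) (fun=> 0%N) (fr_aug F);
  mfr_surjective  : forall f : {mpoly K[n]},
    exists v : 'rV[{mpoly K[n]}]_(fr_rank F 0),
      I (f - (v *m fr_aug F) ord0 ord0);
  mfr_exact0 : forall v : 'rV[{mpoly K[n]}]_(fr_rank F 0),
    I ((v *m fr_aug F) ord0 ord0) <-> exists w, v = w *m fr_diff F 0;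
  mfr_exact : forall i (v : 'rV[{mpoly K[n]}]_(fr_rank F i.+1)),
    v *m fr_diff F i = 0 <-> exists w, v = w *m fr_diff F i.+1;
  mfr_minimal : forall i a b, (fr_diff F i a b)@_0%MM = 0
}.

Definition betti (K : fieldType) (n : nat) (F : free_complex K n) (i j : nat)
    : nat :=
  #|[set a | @fr_deg _ _ F i a == j]|.

(* reg (S/I) = r *)
Definition is_reg_quotient (K : fieldType) (n : nat)
    (I : {mpoly K[n]} -> Prop) (r : int) : Prop :=
  exists F : free_complex K n,
    [/\ minimal_free_resolution I F,
        exists i j, betti F i j <> 0%N /\ r = j%:Z - i%:Z
      & forall i j, betti F i j <> 0%N -> j%:Z - i%:Z <= r].

(* reg I = r, that is, reg (S/I) = r - 1; this gives reg (0) = 1. *)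
Definition is_reg_ideal (K : fieldType) (n : nat)
    (I : {mpoly K[n]} -> Prop) (r : int) : Prop :=
  is_reg_quotient I (r - 1).

(** * Graphs, joins and the ideal I(X_G) *)

(* A finite simple graph is a symmetric irreflexive relation on a finType; its
   edges are two-element sets of vertices. *)
Definition edges (V : finType) (adj : rel V) : {set {set V}} :=
  [set [set p.1; p.2] | p : V * V & adj p.1 p.2].

(* The edges {v_0,v_1}, ..., {v_(k-1),v_0} of the closed walk through
   v_0, ..., v_(k-1). *)
Definition closed_walk_edges (V : finType) (p : seq V) : seq {set V} :=
  [seq [set e.1; e.2] | e <- zip p (rot 1 p)].

Definition circuit (V : finType) (adj : rel V) (p : seq V) : bool :=
  cycle adj p && uniq (closed_walk_edges p).

Definition is_join (V : finType) (adj : rel V) (J : {set {set V}}) : Prop :=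
  J \subset edges adj /\
  forall p, circuit adj p ->
    let EC := [set e in closed_walk_edges p] in
    (#|J :&: EC|%:R <= #|EC|%:R / 2 :> rat).

Definition max_vertex_join_number (V : finType) (adj : rel V) : nat :=
  \max_(J : {set {set V}} | `[< is_join adj J >]) #|J|.

(* The variable of index i in {mpoly K[#|V|]} is x_v for v = enum_val i; the
   variable of index i in {mpoly K[#|edges adj|]} is t_e for e = enum_val i. *)
Definition theta (K : fieldType) (V : finType) (adj : rel V)
    (f : {mpoly K[#|edges adj|]}) : {mpoly K[#|V|]} :=
  f \mPo [tuple \prod_(v in enum_val i) 'X_(enum_rank v) | i < #|edges adj|].

Definition IX (K : fieldType) (V : finType) (adj : rel V)
    (f : {mpoly K[#|edges adj|]}) : Prop :=
  generated_by (fun p : V * V =>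
      'X_(enum_rank p.1) ^+ 2 - 'X_(enum_rank p.2) ^+ 2 : {mpoly K[#|V|]})
    (theta f).

(* Main.v *)
Require Import Defs.
From HB Require Import structures.
From mathcomp Require Import all_boot all_order all_algebra.
From mathcomp Require Import boolp.
From mathcomp Require Import ssrcomplements mpoly zify ring.

Set Implicit Arguments.
Unset Strict Implicit.
Unset Printing Implicit Defensive.

Import Order.TTheory GRing.Theory Num.Theory.
Local Open Scope ring_scope.

(* Let S = K[E_G], e an edge and F the resolution of S/I(X_G). The variable t_e
   is regular on S/I(X_G), and S/(I(X_G), t_e) is Artinian since
   t_f^2 = t_e^2 mod I(X_G). A socle element f of degree d of this quotient is
   carried by connecting homomorphisms, adding one variable at a time, to nonzero
   classes of degree d + i in Tor_i(S/I(X_G), S/(t_a : a in A)) with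
   |A| = i + 1; when A contains all n variables this class forces a generator of
   F_(n-1) of degree at least d + n - 1, so reg S/I(X_G) >= d. It remains to find
   a monomial of degree |J| - 1 outside (I(X_G), t_e) for a join J: if e is in J,
   the product of the variables in J \ e is one. Indeed I(X_G) identifies two
   monomials exactly when they have the same degree and the same boundary modulo
   2, so otherwise the symmetric difference of J \ e with the odd part of some
   multiple of t_e would be a union of edge-disjoint circuits violating the join
   inequality. *)

(** * Linear maps given on monomials *)

Section MonomialExtension.
Variables (K : fieldType) (n k : nat) (phi : 'X_{1..n} -> {mpoly K[k]}).

Definition mext (p : {mpoly K[n]}) : {mpoly K[k]} :=
  \sum_(m <- msupp p) p@_m *: phi m.

(** A range of summation shared by several polynomials lets linearity be checked one monomial at a
    time. *)
Lemma mextE (d : nat) p : (msize p <= d)%N ->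
  mext p = \sum_(m : 'X_{1..n < d}) p@_m *: phi m.
Proof.
move=> le_pd; pose I := 'X_{1..n < d}.
rewrite /mext (big_mksub I) ?msupp_uniq //=; first last.
  by move=> m /msize_mdeg_lt /leq_trans; apply.
rewrite big_rmcond //= => m.
by move/memN_msupp_eq0=> ->; rewrite scale0r.
Qed.

Lemma mext_is_linear : linear mext.
Proof.
move=> c p q; pose d := maxn (msize (c *: p + q)) (maxn (msize p) (msize q)).
rewrite !(@mextE d) /d ?leq_max ?leqnn ?orbT // scaler_sumr -big_split /=.
by apply: eq_bigr => m _; rewrite mcoeffD mcoeffZ scalerDl scalerA.
Qed.

HB.instance Definition _ := GRing.isLinear.Build K {mpoly K[n]} {mpoly K[k]} _
  mext mext_is_linear.

Lemma mextX m : mext 'X_[m] = phi m.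
Proof. by rewrite /mext msuppX big_seq1 mcoeffX eqxx scale1r. Qed.

End MonomialExtension.

Lemma linear_mpoly_eq (K : fieldType) (n : nat) (W : lmodType K)
    (f g : {linear {mpoly K[n]} -> W}) :
  (forall m, f 'X_[m] = g 'X_[m]) -> f =1 g.
Proof.
move=> fg p; rewrite [p]mpolyE !linear_sum.
by apply: eq_bigr => m _; rewrite !linearZ fg.
Qed.

(** * Discarding the terms of low degree *)

Section Truncation.
Variables (K : fieldType) (n : nat).
Implicit Types (p q : {mpoly K[n]}) (t : nat).

(** Keeping all degrees from [t] on, rather than degree [t] alone, makes thresholds given by natural
    subtraction correct: a negative one becomes 0 and still keeps everything. *)
Definition trunc t : {mpoly K[n]} -> {mpoly K[n]} :=
  mext (fun m => if (t <= mdeg m)%N then 'X_[m] else 0).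

HB.instance Definition _ t := GRing.Linear.on (trunc t).

Lemma truncX t m : trunc t 'X_[m] = if (t <= mdeg m)%N then 'X_[m] else 0.
Proof. exact: mextX. Qed.

Lemma mcoeff_trunc t p m :
  (trunc t p)@_m = if (t <= mdeg m)%N then p@_m else 0.
Proof.
rewrite /trunc /mext raddf_sum /=.
rewrite (eq_bigr (fun m' => if (t <= mdeg m)%N then (p@_m' *: 'X_[m'])@_m else 0)); last first.
  move=> m' _; rewrite !mcoeffZ (fun_if (mcoeff m)) mcoeffX mcoeff0.
  have [->|_] := eqVneq m' m; first by case: ifP => _; rewrite ?mulr0.
  by rewrite !mulr0 !if_same mulr0.
case: ifP => _; last by rewrite big1.
by rewrite -raddf_sum /= -mpolyE.
Qed.

(** Multiplication by a form of degree c - c' shifts degrees by that amount; natural subtraction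
    does no harm because D - c <= k means D <= c + k. *)
Lemma truncM (c c' D : nat) p q :
  (forall m, m \in msupp q -> (mdeg m + c')%N = c) ->
  trunc (D - c') (p * q) = trunc (D - c) p * q.
Proof.
move=> hq; rewrite [p]mpolyE [q]mpolyE mulr_suml !linear_sum mulr_suml.
apply: eq_bigr => m _ /=; rewrite !mulr_sumr linear_sum.
rewrite big_seq [RHS]big_seq; apply: eq_bigr => m' /hq hm' /=.
rewrite linearZ -!scalerAl -!scalerAr !linearZ /= -mpolyXD !truncX mdegD.
have -> : (D - c' <= mdeg m + mdeg m')%N = (D - c <= mdeg m)%N.
  by rewrite !leq_subLR -hm' [(mdeg m' + c')%N]addnC -addnA [(mdeg m' + _)%N]addnC.
by case: ifP => _; rewrite ?mul0r ?scaler0 // mpolyXD scalerA mulrC -scalerA.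
Qed.

End Truncation.

(** * Setting variables to zero *)

Section Specialization.
Variables (K : fieldType) (n : nat).
Implicit Types (A B : {set 'I_n}) (p q : {mpoly K[n]}).

(** Models S -> S/(x_a : a in A) inside S itself: congruence modulo these variables is equality of
    images under [vanish A]. *)
Definition vanish A (p : {mpoly K[n]}) : {mpoly K[n]} :=
  p \mPo [tuple if i \in A then 0 else 'X_i | i < n].

Let vanish_is_linear A : linear (vanish A).
Proof. by move=> c p q; rewrite /vanish comp_mpolyD comp_mpolyZ. Qed.

HB.instance Definition _ A := GRing.isLinear.Build K {mpoly K[n]} {mpoly K[n]} _
  (vanish A) (vanish_is_linear A).

Let vanish_is_multiplicative A : multiplicative (vanish A).
Proof. exact: comp_mpoly_is_multiplicative. Qed.

HB.instance Definition _ A := GRing.isMultiplicative.Build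
  {mpoly K[n]} {mpoly K[n]} (vanish A) (vanish_is_multiplicative A).

Lemma vanishU A i : vanish A 'X_i = if i \in A then 0 else 'X_i.
Proof. by rewrite /vanish comp_mpolyXU -tnth_nth tnth_mktuple. Qed.

Lemma vanishX A m :
  vanish A 'X_[m] = if [exists i in A, m i != 0%N] then 0 else 'X_[m].
Proof.
rewrite /vanish comp_mpolyX; case: ifP => [/exists_inP[i iA mi]|].
  by rewrite (bigD1 i) //= tnth_mktuple iA expr0n (negPf mi) mul0r.
move/negbT; rewrite negb_exists_in => /forall_inP mA.
rewrite mpolyXE_id; apply: eq_bigr => i _; rewrite tnth_mktuple.
case: ifP => // iA; have := mA i iA; rewrite negbK => /eqP ->.
by rewrite !expr0.
Qed.

Lemma vanish_comp A B p : vanish A (vanish B p) = vanish (A :|: B) p.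
Proof.
refine (@linear_mpoly_eq K n {mpoly K[n]} (vanish A \o vanish B) (vanish (A :|: B)) _ p) => m /=.
rewrite !vanishX; case: (boolP [exists i in B, m i != 0%N]) => hB.
  rewrite raddf0 ifT //; case/exists_inP: hB => i iB mi.
  by apply/exists_inP; exists i; rewrite ?inE ?iB ?orbT.
rewrite vanishX; congr (if _ then _ else _); apply/exists_inP/exists_inP.
  by case=> i iA mi; exists i; rewrite // inE iA.
case=> i; rewrite inE => /orP[iA mi|iB mi]; first by exists i.
by case/negP: hB; apply/exists_inP; exists i.
Qed.

Lemma vanish_subset A (B : {set _}) p q : A \subset B ->
  vanish A p = vanish A q -> vanish B p = vanish B q.
Proof. by move/setUidPl => <- e; rewrite -!vanish_comp e. Qed.

Lemma vanish1_eq0 x p : vanish [set x] p = 0 -> exists q, p = 'X_x * q.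
Proof.
suff [q e] : exists q, p = 'X_x * q + vanish [set x] p.
  by move=> p0; exists q; rewrite e p0 addr0.
elim/mpolyind: p => [|c m p _ _ [q {1}->]].
  by exists 0; rewrite raddf0 mulr0 addr0.
rewrite linearD linearZ /= vanishX; case: ifP => [|_]; last first.
  by exists q; rewrite addrCA addrA.
case/exists_inP=> i /set1P ->{i}; rewrite -lt0n => mx.
exists (c *: 'X_[m - U_(x)] + q); rewrite scaler0 add0r mulrDr -scalerAr -mpolyXD.
by rewrite addmC submK ?addrA // lep1mP -lt0n.
Qed.

(** The one-variable case applied to [vanish A p]: the kernel of S/(A) -> S/(A, x) is generated by
    x. *)
Lemma vanishU1_eq0 A x p : x \notin A ->
  vanish (x |: A) p = 0 -> exists q, vanish A p = vanish A ('X_x * q).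
Proof.
move=> xA; rewrite -vanish_comp => /vanish1_eq0[q e]; exists q.
by rewrite -[in RHS]e vanish_comp setUid.
Qed.

Lemma mcoeff0_vanishT p : vanish setT p = (p@_0)%:MP.
Proof.
elim/mpolyind: p => [|c m p _ _ IH]; first by rewrite raddf0 mcoeff0.
rewrite linearD linearZ /= IH mcoeffD mcoeffZ mcoeffX vanishX raddfD /=.
congr (_ + _); case: ifP => [/exists_inP[i _ mi]|/negbT hm].
  have /negPf-> : m != 0%MM by apply: contraNneq mi => ->; rewrite mnm0E.
  by rewrite mulr0 scaler0 mpolyC0.
suff -> : m = 0%MM by rewrite eqxx mpolyX0 mulr1 -mul_mpolyC mulr1.
apply/mnmP => i; rewrite mnm0E; apply: contraNeq hm => mi.
by apply/exists_inP; exists i; rewrite ?inE.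
Qed.

Lemma vanish_trunc A t p : vanish A (trunc t p) = trunc t (vanish A p).
Proof.
refine (@linear_mpoly_eq K n {mpoly K[n]} (vanish A \o trunc t) (trunc t \o vanish A) _ p) => m /=.
rewrite truncX (fun_if (vanish A)) vanishX raddf0.
by rewrite (fun_if (trunc t)) raddf0 truncX; do 2 case: ifP.
Qed.

End Specialization.

(** * Specialization of matrices, entry by entry *)

Section SpecializedMatrices.
Variables (K : fieldType) (n p q : nat).
Implicit Types (A B : {set 'I_n}) (M N : 'M[{mpoly K[n]}]_(p, q)).

Lemma map_vanish_subset A B M N : A \subset B ->
  map_mx (vanish A) M = map_mx (vanish A) N ->
  map_mx (vanish B) M = map_mx (vanish B) N.
Proof.
move=> AB /matrixP e; apply/matrixP => i j; have := e i j.
by rewrite !mxE; apply: vanish_subset.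
Qed.

Lemma map_vanish1_eq0 x M :
  map_mx (vanish [set x]) M = 0 -> exists N, M = 'X_x *: N.
Proof.
move/matrixP=> e.
have h ij : exists g, M ij.1 ij.2 = 'X_x * g.
  by apply: vanish1_eq0; have := e ij.1 ij.2; rewrite !mxE.
have [g hg] := choice h.
by exists (\matrix_(i, j) g (i, j)); apply/matrixP => i j; rewrite !mxE (hg (i, j)).
Qed.

Lemma map_vanishU1_eq0 A x M : x \notin A ->
  map_mx (vanish (x |: A)) M = 0 ->
  exists N, map_mx (vanish A) M = map_mx (vanish A) ('X_x *: N).
Proof.
move=> xA /matrixP e.
have h ij : exists g, vanish A (M ij.1 ij.2) = vanish A ('X_x * g).
  by apply: vanishU1_eq0 => //; have := e ij.1 ij.2; rewrite !mxE.
have [g hg] := choice h.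
by exists (\matrix_(i, j) g (i, j)); apply/matrixP => i j; rewrite !mxE (hg (i, j)).
Qed.

Lemma map_vanish_in A x M : x \in A -> map_mx (vanish A) ('X_x *: M) = 0.
Proof. by move=> xA; rewrite map_mxZ /= vanishU xA scale0r. Qed.

Lemma scaleX_eq0 x M : 'X_x *: M = 0 -> M = 0.
Proof.
move/matrixP=> e; apply/matrixP => i j; have /eqP := e i j.
rewrite !mxE mulf_eq0 => /orP[|/eqP//].
by rewrite -msupp_eq0 msuppX.
Qed.

Lemma map_vanish_cancel A x M : x \notin A ->
  map_mx (vanish A) ('X_x *: M) = 0 -> map_mx (vanish A) M = 0.
Proof. by move=> xA; rewrite map_mxZ /= vanishU (negPf xA); apply: scaleX_eq0. Qed.

End SpecializedMatrices.

(** * Socle elements and Betti numbers *)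

Section MinimalResolution.
Variables (K : fieldType) (n : nat) (I : {mpoly K[n]} -> Prop).
Variables (F : free_complex K n) (resF : minimal_free_resolution I F).
Hypotheses (I_add : forall p q, I p -> I q -> I (p + q))
           (I_mul : forall p q, I q -> I (p * q)).
Variables (e : 'I_n) (e_regular : forall p, I ('X_e * p) -> I p).

Local Notation rk := (fr_rank F).
Local Notation dF := (fr_diff F).
Implicit Types A : {set 'I_n}.

Local Notation rowF i := 'rV[{mpoly K[n]}]_(rk i).

Definition augment (v : rowF 0) : {mpoly K[n]} := (v *m fr_aug F) ord0 ord0.

Lemma augment_is_scalar : scalar augment.
Proof. by move=> p u v; rewrite /augment mulmxDl -scalemxAl 2!mxE. Qed.

HB.instance Definition _ := GRing.isLinear.Build {mpoly K[n]} (rowF 0)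
  {mpoly K[n]} *%R augment augment_is_scalar.

Lemma diff_diff i (w : rowF i.+2) : w *m dF i.+1 *m dF i = 0.
Proof. by apply/(mfr_exact resF); exists w. Qed.

Lemma augment_diff (w : rowF 1) : I (augment (w *m dF 0)).
Proof. by apply/(mfr_exact0 resF); exists w. Qed.

(** x_e is regular on the cokernel of every differential: that of [dF 0] is S/I, and each later one
    embeds in a free module. *)
Lemma boundary_cancel i (v : rowF i) w :
  'X_e *: v = w *m dF i -> exists u, v = u *m dF i.
Proof.
case: i v w => [|i] v w evw.
  apply/(mfr_exact0 resF)/e_regular.
  by have := augment_diff w; rewrite -evw linearZ.
apply/(mfr_exact resF)/(@scaleX_eq0 _ _ _ _ e).
by rewrite scalemxAl evw diff_diff.
Qed.

(** Vanishing of Tor_(i+1)(S/I, S/(x_a : a in A)) for |A| <= i + 1. For A = {e} it is regularity of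
    x_e; each further variable costs one homological degree, by the long exact sequence of
    multiplication by x. *)
Lemma exact_specialized A i (v : rowF i.+1) :
  e \in A -> (#|A| <= i.+1)%N -> map_mx (vanish A) (v *m dF i) = 0 ->
  exists w, map_mx (vanish A) v = map_mx (vanish A) (w *m dF i.+1).
Proof.
move: {2}#|A :\ e| (erefl #|A :\ e|) => k.
elim: k A i v => [|k IH] A i v cA eA Ai hv.
  have {}eA : A = [set e].
    by rewrite -(setD1K eA); move/eqP: cA; rewrite cards_eq0 => /eqP->; rewrite setU0.
  rewrite eA in hv *.
  have [w hw] := map_vanish1_eq0 hv.
  have [u hu] := boundary_cancel (esym hw).
  have [y hy] : exists y, v - 'X_e *: u = y *m dF i.+1.
    by apply/(mfr_exact resF); rewrite mulmxBl -scalemxAl -hu hw subrr.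
  exists y; rewrite -hy map_mxB [X in _ - X]map_vanish_in ?set11 //.
  by rewrite subr0.
have [x] : exists x, x \in A :\ e by apply/card_gt0P; rewrite cA.
rewrite !inE => /andP[xe xA]; pose B := A :\ x.
have xB : x \notin B by rewrite !inE eqxx.
have eB : e \in B by rewrite !inE eq_sym xe.
have AB : A = x |: B by rewrite setD1K.
have cB : #|B :\ e| = k.
  by move: cA; rewrite (cardsD1 x (A :\ e)) !inE xe xA /= /B setDDl setUC -setDDl => -[].
have cA1 : #|A| = #|B|.+1 by rewrite (cardsD1 x A) xA.
have hi : (#|B| <= i)%N by rewrite -ltnS -cA1.
(* The case i = 0 would force B to be empty, but B contains e. *)
case: i => [|i] in v Ai hv hi *.
  by move: hi; rewrite leqn0 cards_eq0 => /eqP B0; rewrite B0 inE in eB.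
rewrite AB in hv *.
have [w hw] := map_vanishU1_eq0 xB hv.
(* Modulo B, x w is the image of v under the differential; since x can be cancelled, w is a cycle,
   hence a boundary. Then v - x u is a cycle modulo B and agrees with v modulo A. *)
have [u hu] : exists u, map_mx (vanish B) w = map_mx (vanish B) (u *m dF i.+1).
  apply: IH => //; apply: (@map_vanish_cancel _ _ _ _ _ x) => //.
  rewrite scalemxAl map_mxM -hw -map_mxM diff_diff.
  by rewrite map_mx0.
have [y hy] : exists y, map_mx (vanish B) (v - 'X_x *: u) =
                        map_mx (vanish B) (y *m dF i.+2).
  apply: IH => //; first exact: leq_trans hi _.
  rewrite mulmxBl -scalemxAl map_mxB hw.
  by rewrite !map_mxZ hu subrr.
exists y; rewrite -(map_vanish_subset (subsetUr _ _) hy) map_mxB.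
by rewrite [X in _ - X]map_vanish_in ?subr0 // setU11.
Qed.

(** The part of degree at least [D] in the grading of F_i, where coordinate [a] is shifted by
    [fr_deg a]. *)
Definition trunc_row i (D : nat) (v : rowF i) : rowF i :=
  \row_a trunc (D - fr_deg a) (v ord0 a).

Lemma trunc_rowM i D (w : rowF i.+1) :
  trunc_row D (w *m dF i) = trunc_row D w *m dF i.
Proof.
apply/rowP => b; rewrite !mxE raddf_sum; apply: eq_bigr => a _ /=.
rewrite mxE; apply: truncM => m; exact: (mfr_diff_graded resF).
Qed.

Lemma trunc_rowX i D x (v : rowF i) :
  trunc_row D.+1 ('X_x *: v) = 'X_x *: trunc_row D v.
Proof.
apply/rowP => a; rewrite !mxE mulrC (@truncM _ _ (fr_deg a).+1).
  by rewrite subSS mulrC.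
by move=> m; rewrite msuppX inE => /eqP->; rewrite mdeg1.
Qed.

Definition boundary_mod A i (v : rowF i) : Prop :=
  exists w, map_mx (vanish A) v = map_mx (vanish A) (w *m dF i).

(* A socle element of degree [D] in the [i]-th homology of F/(x_a : a \in A)F. *)
Definition socle_class A i D (v : rowF i) : Prop :=
  [/\ trunc_row D v = v, ~ boundary_mod A v &
      forall j, boundary_mod A ('X_j *: v)].

Lemma map_vanish_trunc_row A i D (v w : rowF i) :
  map_mx (vanish A) v = map_mx (vanish A) w ->
  map_mx (vanish A) (trunc_row D v) = map_mx (vanish A) (trunc_row D w).
Proof.
move/rowP=> vw; apply/rowP => a; have := vw a.
by rewrite !mxE !vanish_trunc => ->.
Qed.

(** The connecting homomorphism: x v is a boundary modulo A, and any w that it bounds is a cycle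
    modulo A and x. Since x v lives in degrees at least D + 1, w may be truncated there. *)
Lemma socle_class_step A i D x (v : rowF i) :
  e \in A -> (#|A| <= i.+1)%N -> x \notin A -> socle_class A D v ->
  exists w, @socle_class (x |: A) i.+1 D.+1 w.
Proof.
move=> eA Ai xA [vD vB vX].
have [w hw] : exists w, map_mx (vanish A) ('X_x *: v) =
                        map_mx (vanish A) (trunc_row D.+1 w *m dF i).
  have [w hw] := vX x; exists w.
  by rewrite -trunc_rowM -{1}vD -trunc_rowX; apply: map_vanish_trunc_row.
exists (trunc_row D.+1 w); set w' := trunc_row _ w in hw *.
have sA : A \subset x |: A by apply: subsetUr.
split.
- apply/rowP => a; rewrite !mxE; apply/mpolyP => m.
  by rewrite !mcoeff_trunc; case: leqP.
- move=> [u hu]; apply: vB.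
  (* If w' were the boundary of u modulo A and x, then x v would be the boundary of x z modulo A;
     cancelling x makes v a boundary. *)
  have [z hz] : exists z, map_mx (vanish A) (w' - u *m dF i.+1) =
                          map_mx (vanish A) ('X_x *: z).
    by apply: map_vanishU1_eq0; rewrite // map_mxB hu subrr.
  exists z; apply/eqP; rewrite -subr_eq0 -map_mxB; apply/eqP.
  apply: (@map_vanish_cancel _ _ _ _ _ x) => //.
  rewrite scalerBr map_mxB hw scalemxAl [X in _ - X]map_mxM -hz -map_mxM.
  by rewrite mulmxBl diff_diff subr0 subrr.
- move=> j; have [y hy] := vX j.
  (* Both terms have boundary x x_j v modulo A, so their difference is a cycle and exactness
     applies; the second term dies modulo x. *)
  have [u hu] : exists u, map_mx (vanish A) ('X_j *: w' - 'X_x *: y) =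
                          map_mx (vanish A) (u *m dF i.+1).
    apply: (exact_specialized eA Ai).
    rewrite mulmxBl -!scalemxAl map_mxB !map_mxZ -hw -hy.
    by rewrite !map_mxZ !scalerA mulrC subrr.
  exists u; rewrite -(map_vanish_subset sA hu) map_mxB.
  by rewrite [X in _ - X]map_vanish_in ?subr0 // setU11.
Qed.

(* The hypotheses on [a] say that 'X_[a] is a nonzero socle element of
   S/(I + (x_e)). *)
Lemma socle_betti (a : 'X_{1..n}) :
    ~ (exists g, I ('X_[a] - 'X_e * g)) ->
    (forall j, exists g, I ('X_j * 'X_[a] - 'X_e * g)) ->
  exists i j, betti F i j <> 0%N /\ (mdeg a + i <= j)%N.
Proof.
move=> aI aX.
(* [y] lifts 1, so 'X_[a] *: y represents the given monomial in F_0. *)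
have [y hy] := mfr_surjective resF 1.
have chain k : (k < n)%N -> exists A : {set 'I_n}, exists v : rowF k,
    [/\ e \in A, #|A| = k.+1 & socle_class A (mdeg a + k) v].
  elim: k => [|k IH] hk.
    exists [set e], ('X_[a] *: y); split; rewrite ?set11 ?cards1 //.
    (* The cokernel of [dF 0] modulo x_e is S/(I, x_e), so the hypotheses on [a] become the socle
       conditions in F_0. *)
    have mod_e (v : rowF 0) :
        boundary_mod [set e] v <-> exists g, I (augment v - 'X_e * g).
      split=> [[w]|[g hg]].
        move/eqP; rewrite -subr_eq0 -map_mxB => /eqP/map_vanish1_eq0[z].
        move/eqP; rewrite subr_eq => /eqP->; exists (augment z).
        by rewrite linearP /= addrAC subrr add0r; apply: augment_diff.
      have [w hw] : exists w, v - 'X_e *: (g *: y) = w *m dF 0.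
        apply/(mfr_exact0 resF); rewrite -/(augment _).
        have := I_add hg (I_mul ('X_e * g) hy).
        by rewrite linearB !linearZ /= -/(augment y); congr I; ring.
      exists w; rewrite -hw map_mxB.
      by rewrite [X in _ - X]map_vanish_in ?subr0 ?set11.
    split.
    - rewrite addn0; apply/rowP => b; rewrite !mxE mulrC.
      rewrite (@truncM _ _ (mdeg a + fr_deg b)).
        rewrite subnDA subnn sub0n; congr (_ * _).
        by apply/mpolyP => m; rewrite mcoeff_trunc.
      by move=> m; rewrite msuppX inE => /eqP->.
    - move/mod_e => [g hg]; apply: aI; exists g.
      have := I_add hg (I_mul 'X_[a] hy).
      by rewrite linearZ /= -/(augment y); congr I; ring.
    - move=> j; apply/mod_e; have [g hg] := aX j.
      exists (g * augment y); have := I_mul (augment y) hg.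
      by rewrite !linearZ /=; congr I; ring.
  have [A [v [eA cA sA]]] := IH (ltnW hk).
  have [x xA] : exists x, x \notin A.
    apply/existsP; rewrite -negb_forall; apply/negP => /forallP h.
    have : A = setT by apply/setP => x; rewrite h inE.
    by move/(congr1 (fun B : {set _} => #|B|)); rewrite cA cardsT card_ord; lia.
  have [] := socle_class_step eA _ xA sA; first by rewrite cA.
  rewrite -addnS => w hw; exists (x |: A), w.
  by split; rewrite ?inE ?eA ?orbT // cardsU1 xA cA.
have n_gt0 : (0 < n)%N by apply: leq_ltn_trans (ltn_ord e).
have [|A [v [_ cA [vD vB _]]]] := chain n.-1; first by rewrite prednK.
have AT : A = setT.
  by apply/eqP; rewrite eqEcard subsetT cardsT card_ord cA prednK /=.
(* After n - 1 steps every variable is killed, so a vector without constant terms would be 0 and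
   hence a boundary. A constant term at [b] survives the truncation only if [fr_deg b] is at least
   mdeg a + n - 1. *)
have [b hb] : exists b, (v ord0 b)@_0 != 0.
  apply: contrapT => h; apply: vB; exists 0; rewrite mul0mx map_mx0 AT.
  apply/rowP => b; rewrite !mxE mcoeff0_vanishT.
  by apply/eqP; rewrite mpolyC_eq0; apply: contra_notT h => hb; exists b.
exists n.-1, (fr_deg b); split.
  by apply/eqP; rewrite /betti -lt0n; apply/card_gt0P; exists b; rewrite inE.
move/rowP/(_ b)/(congr1 (mcoeff 0)): vD hb; rewrite mxE mcoeff_trunc mdeg0.
by case: ifP => [|_ <-]; [rewrite leqn0 subn_eq0 | rewrite eqxx].
Qed.

End MinimalResolution.
(** * The ideal of differences of squares *)

Section GeneratedIdeal.
Variables (T : finType) (R : comNzRingType) (g : T -> R).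

Lemma generated_by0 : generated_by g 0.
Proof. by exists (fun=> 0); rewrite big1 // => t _; rewrite mul0r. Qed.

Lemma generated_byD p q :
  generated_by g p -> generated_by g q -> generated_by g (p + q).
Proof.
move=> [c ->] [d ->]; exists (fun t => c t + d t).
by rewrite -big_split; apply: eq_bigr => t _; rewrite mulrDl.
Qed.

Lemma generated_byM p q : generated_by g q -> generated_by g (p * q).
Proof.
move=> [c ->]; exists (fun t => p * c t).
by rewrite mulr_sumr; apply: eq_bigr => t _; rewrite mulrA.
Qed.

Lemma generated_by_gen t : generated_by g (g t).
Proof.
exists (fun t' => (t' == t)%:R); rewrite (bigD1 t) //= eqxx mul1r big1 ?addr0 //.
by move=> t' /negPf->; rewrite mul0r.
Qed.

Lemma generated_by_subM a b c d :
  generated_by g (a - b) -> generated_by g (c - d) -> generated_by g (a * c - b * d).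
Proof.
move=> /(generated_byM c) hab /(generated_byM b) hcd.
have := generated_byD hab hcd; congr generated_by; ring.
Qed.

Lemma generated_by_subX a b k :
  generated_by g (a - b) -> generated_by g (a ^+ k - b ^+ k).
Proof.
move=> hab; elim: k => [|k IH]; first by rewrite subrr; apply: generated_by0.
by rewrite !exprS; apply: generated_by_subM.
Qed.

End GeneratedIdeal.

Section SquareDifferences.
Variables (K : fieldType) (V : finType) (v0 : V).
Local Notation S := {mpoly K[#|V|]}.
Local Notation o := (enum_rank v0).

Definition square_ideal : S -> Prop :=
  generated_by (fun p : V * V =>
      'X_(enum_rank p.1) ^+ 2 - 'X_(enum_rank p.2) ^+ 2 : S).

Definition half_degree (m : 'X_{1..#|V|}) : nat := (\sum_i (m i)./2)%N.

Definition normal_monomial (m : 'X_{1..#|V|}) : 'X_{1..#|V|} :=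
  ([multinom (odd (m i) : nat) | i < #|V|] + (U_(o) *+ 2) *+ half_degree m)%MM.

(* K-linear, with kernel the ideal of differences of squares: each x_i^2 is
   replaced by x_o^2. *)
Definition normal_form : S -> S := mext (fun m => 'X_[normal_monomial m]).

HB.instance Definition _ := GRing.Linear.on normal_form.

Lemma normal_formX m : normal_form 'X_[m] = 'X_[normal_monomial m].
Proof. exact: mextX. Qed.

Lemma normal_monomialD2 i m :
  normal_monomial (U_(i) *+ 2 + m)%MM = (U_(o) *+ 2 + normal_monomial m)%MM.
Proof.
rewrite /normal_monomial.
have -> : half_degree (U_(i) *+ 2 + m)%MM = (half_degree m).+1.
  rewrite /half_degree (bigD1 i) //= [in RHS](bigD1 i) //=.
  rewrite mnmDE mulmnE mnm1E eqxx mul1n add2n /= addSn; congr (_ + _).+1.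
  apply: eq_bigr => j ji; rewrite mnmDE mulmnE mnm1E eq_sym.
  by rewrite (negPf ji).
rewrite (mulmS (U_(o) *+ 2)%MM) [LHS]addmA [RHS]addmA; congr (_ + _)%MM.
rewrite addmC; congr (_ + _)%MM.
by apply/mnmP => j; rewrite [LHS]mnmE mnmDE mulmnE oddD oddM andbF [RHS]mnmE.
Qed.

Lemma normal_form_mulX2 i p :
  normal_form ('X_i ^+ 2 * p) = 'X_o ^+ 2 * normal_form p.
Proof.
rewrite [p]mpolyE mulr_sumr !linear_sum mulr_sumr; apply: eq_bigr => m _ /=.
rewrite -scalerAr !linearZ /= -scalerAr; congr (_ *: _).
by rewrite !mpolyXn -mpolyXD !normal_formX normal_monomialD2 mpolyXD.
Qed.

Lemma square_ideal_sub_normal_form p : square_ideal (p - normal_form p).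
Proof.
elim/mpolyind: p => [|c m p _ _ IH].
  by rewrite linear0 subrr; apply: generated_by0.
rewrite linearP /= opprD addrACA; apply: generated_byD => //.
rewrite -scalerBr -mul_mpolyC; apply: generated_byM.
rewrite normal_formX /normal_monomial mpolyXD mpolyXE_id.
rewrite -[('X_[_ *+ half_degree m])]mpolyXn -mpolyXn /half_degree -prodrXr.
rewrite [X in _ - X * _]mpolyXE_id -big_split /=.
(* The two products are compared factor by factor: x_i^(m i) against its parity part times a power
   of x_o^2. *)
apply: (big_ind2 (fun a b => square_ideal (a - b))) => [||i _].
- by rewrite subrr; apply: generated_by0.
- by move=> a b a' b'; apply: generated_by_subM.
rewrite mnmE -{1}(odd_double_half (m i)) exprD -mul2n exprM.
apply: generated_by_subM; first by rewrite subrr; apply: generated_by0.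
apply: generated_by_subX; rewrite -{1}(enum_valK i).
exact: (generated_by_gen _ (enum_val i, v0)).
Qed.

Lemma square_idealE p : square_ideal p <-> normal_form p = 0.
Proof.
split=> [[c ->]|p0]; last first.
  by rewrite -[p]subr0 -p0; apply: square_ideal_sub_normal_form.
rewrite linear_sum big1 // => -[i j] _ /=.
by rewrite mulrC mulrBl linearB /= !normal_form_mulX2 subrr.
Qed.

(** After one more multiplication by x_i, the square x_i^2 acts on normal forms as x_o^2, which is a
    nonzerodivisor. *)
Lemma square_ideal_cancelX i p : square_ideal ('X_i * p) -> square_ideal p.
Proof.
move/(generated_byM 'X_i); rewrite mulrA -expr2 => /square_idealE.
rewrite normal_form_mulX2 => /eqP; rewrite mulf_eq0 expf_eq0 /=.
by rewrite -[X in X || _]msupp_eq0 msuppX /= => /eqP /square_idealE.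
Qed.

(** The degree and the parities determine the number of squares that can be extracted. *)
Lemma normal_monomial_eq m m' : mdeg m = mdeg m' ->
  (forall i, odd (m i) = odd (m' i)) -> normal_monomial m = normal_monomial m'.
Proof.
move=> dm om; have mdegE' m1 : mdeg m1 = (\sum_i odd (m1 i) + 2 * half_degree m1)%N.
  rewrite mdegE /half_degree big_distrr -big_split /=.
  by apply: eq_bigr => i _; rewrite mul2n odd_double_half.
have hm : half_degree m = half_degree m'.
  move: dm; rewrite !mdegE' (eq_bigr _ (fun i _ => congr1 nat_of_bool (om i))).
  by move/addnI/eqP; rewrite eqn_pmul2l // => /eqP.
rewrite /normal_monomial hm; congr (_ + _)%MM.
by apply/mnmP => i; rewrite !mnmE om.
Qed.

Lemma normal_monomial_inj m m' : normal_monomial m = normal_monomial m' ->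
  mdeg m = mdeg m' /\ forall i, odd (m i) = odd (m' i).
Proof.
have mdegE' m1 : mdeg (normal_monomial m1) = mdeg m1.
  rewrite mdegD !mdegMn mdeg1 mul1n !mdegE /half_degree big_distrr -big_split /=.
  by apply: eq_bigr => i _; rewrite mnmE mul2n odd_double_half.
have oddE m1 i : odd (normal_monomial m1 i) = odd (m1 i).
  by rewrite mnmDE mnmE 2!mulmnE oddD oddM oddM andbF addbF oddb.
move=> e; split=> [|i]; first by rewrite -(mdegE' m) e mdegE'.
by rewrite -(oddE m) e oddE.
Qed.

End SquareDifferences.
(** * Joins and even edge sets *)

Lemma cycle_zip_rot (T : Type) (r : rel T) (p : seq T) :
  cycle r p = all (fun z => r z.1 z.2) (zip p (rot 1 p)).
Proof.
case: p => [|x p] //; rewrite rot1_cons /=.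
by elim: p {1 3}x => [|y p IH] z //=; rewrite IH.
Qed.

(** Used to see that a cycle on at least three vertices never runs back along an edge. *)
Lemma next_next_neq (T : eqType) (p : seq T) x :
  uniq p -> (2 < size p)%N -> x \in p -> next p (next p x) != x.
Proof.
move=> up sp xp; have [i q rp] := rot_to xp.
rewrite -!(next_rot i up) rp; rewrite -(rot_uniq i) rp in up.
rewrite -(size_rot i) rp in sp.
case: q up sp {rp} => [|y [|z q]] //= /and3P[].
rewrite !inE !negb_or => /and3P[xy xz _] _ _ _.
by rewrite eqxx [y == x]eq_sym (negPf xy) eqxx eq_sym.
Qed.

Section Joins.
Variables (V : finType) (adj : rel V).
Hypotheses (adj_sym : ssrbool.symmetric adj) (adj_irr : irreflexive adj).
Implicit Types (x y z : V) (C J : {set {set V}}) (p : seq V).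

(** Membership in the cycle space over the field with two elements. *)
Definition even_edges C : Prop := forall v, ~~ odd #|[set f in C | v \in f]|.

Lemma edgesP f : reflect (exists x y, adj x y /\ f = [set x; y]) (f \in edges adj).
Proof.
apply: (iffP imsetP) => [[[x y]]|[x [y [xy ->]]]]; last by exists (x, y); rewrite ?inE.
by rewrite inE => xy ->; exists x, y.
Qed.

Lemma adj_neq x y : adj x y -> x != y.
Proof. by apply: contraTneq => ->; rewrite adj_irr. Qed.

Lemma set2_inj (T : finType) (a b c d : T) :
  [set a; b] = [set c; d] -> (a = c /\ b = d) \/ (a = d /\ b = c).
Proof.
move=> e.
have : a \in [set c; d] by rewrite -e set21.
have : b \in [set c; d] by rewrite -e set22.
have : c \in [set a; b] by rewrite e set21.
have : d \in [set a; b] by rewrite e set22.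
by rewrite !inE; do 4![case/orP=> /eqP ?]; first [left; split; congruence | right; split; congruence].
Qed.

Lemma set2_edges x y : ([set x; y] \in edges adj) = adj x y.
Proof.
apply/edgesP/idP => [[a [b [ab]]]|xy]; last by exists x, y.
by case/set2_inj => -[-> ->] //; rewrite adj_sym.
Qed.

(** Each visit to v uses one edge leaving it and one entering it; as there are no loops, these are
    counted separately, each as often as v occurs in [p]. *)
Lemma circuit_even p : circuit adj p ->
  even_edges [set f in closed_walk_edges p].
Proof.
case/andP=> cp up v.
have -> : #|[set f in [set g in closed_walk_edges p] | v \in f]| =
          count (fun f : {set V} => v \in f) (closed_walk_edges p).
  rewrite -size_filter -(card_uniqP (filter_uniq _ up)); apply: eq_card => f.
  by rewrite !inE mem_filter andbC.
move: cp; rewrite cycle_zip_rot /closed_walk_edges count_map.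
set s := zip _ _ => adj_s.
have -> : count (preim (fun e => [set e.1; e.2]) (fun f : {set V} => v \in f)) s =
          (count (fun e => e.1 == v) s + count (fun e => e.2 == v) s)%N.
  rewrite -count_predUI [X in (_ + X)%N](_ : _ = 0%N) ?addn0; last first.
    apply/eqP; rewrite -leqn0 leqNgt -has_count; apply/hasPn => -[a b] /(allP adj_s).
    by move/adj_neq => /=; apply: contra => /andP[/eqP-> /eqP->].
  by apply: eq_count => -[a b] /=; rewrite !inE ![v == _]eq_sym.
have sz : size p = size (rot 1 p) by rewrite size_rot.
have -> : count (fun e => e.1 == v) s = count_mem v p.
  by rewrite -[p in RHS](@unzip1_zip _ _ p (rot 1 p)) ?sz // count_map.
have -> : count (fun e => e.2 == v) s = count_mem v p.
  have /permP <- : perm_eq (rot 1 p) p by rewrite perm_rot.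
  by rewrite -[rot 1 p in RHS](@unzip2_zip _ _ p (rot 1 p)) ?sz // count_map.
by rewrite addnn odd_double.
Qed.

Lemma long_cycle_circuit p :
  uniq p -> (2 < size p)%N -> cycle adj p -> circuit adj p.
Proof.
move=> up sp cp; rewrite /circuit cp map_inj_in_uniq; first exact: zip_uniql.
have nx : all (fun z : V * V => next p z.1 == z.2) (zip p (rot 1 p)).
  by have := cycle_next up; rewrite cycle_zip_rot.
have mem1 (z : V * V) : z \in zip p (rot 1 p) -> z.1 \in p.
  by move/(map_f fst); rewrite [map _ _]unzip1_zip ?size_rot.
move=> [a b] [c d] ab cd /set2_inj /= [[-> ->//]|[ad bc]].
have := next_next_neq up sp (mem1 _ ab).
have /eqP /= -> := allP nx _ ab; rewrite bc.
by have /eqP /= -> := allP nx _ cd; rewrite ad eqxx.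
Qed.

(** A path in C can always be prolonged at its head, because evenness supplies a second edge there;
    finiteness makes it meet itself. *)
Lemma even_edges_circuit C : C \subset edges adj -> even_edges C -> C != set0 ->
  exists p, [/\ circuit adj p, {subset closed_walk_edges p <= C} &
                closed_walk_edges p != [::]].
Proof.
move=> CE evC C0; pose c x y := [set x; y] \in C.
have c_adj x y : c x y -> adj x y by move/(subsetP CE); rewrite set2_edges.
have c_sym x y : c x y = c y x by rewrite /c setUC.
have other x y : c x y -> exists2 z, z != y & c x z.
  move=> cxy; have := evC x; rewrite (cardsD1 [set x; y]) inE -/(c x y) cxy set21 /=.
  rewrite negbK => /odd_gt0 /card_gt0P[f]; rewrite !inE => /and3P[fxy fC xf].
  have /edgesP[a [b [ab fab]]] := subsetP CE f fC; subst f.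
  move: xf; rewrite !inE => /orP[] /eqP xe; subst x.
    by exists b; [apply: contra fxy => /eqP->|].
  exists a; last by rewrite c_sym.
  by apply: contra fxy => /eqP->; rewrite setUC.
have [p [up sp cp]] : exists p, [/\ uniq p, (2 < size p)%N & cycle c p].
  have [f fC] : exists f, f \in C by apply/set0Pn.
  have /edgesP[x [y [xy fxy]]] := subsetP CE f fC; subst f.
  have : uniq [:: x; y] by rewrite /= inE andbT adj_neq.
  have : path c x [:: y] by rewrite /= andbT.
  move: x y [::] {xy fC} => x y p.
  (* Induction on the number of vertices off the path. *)
  have [k] := ubnP (#|V| - size [:: x, y & p])%N.
  elim: k x y p => // k IH x y p hk pth up.
  have [z zy xz] := other x y (proj1 (andP pth)).
  have zx : z != x by rewrite eq_sym adj_neq ?c_adj.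
  have [zp|zp] := boolP (z \in p).
    (* The new vertex z lies beyond y, so the segment from x to z closes up to a cycle with at least
       three vertices. *)
    case/splitPr: zp => p1 p2 in up pth hk *.
    exists [:: x, y & rcons p1 z]; split.
    - apply: (subseq_uniq _ up); rewrite -cat_rcons -!cat_cons.
      exact: prefix_subseq.
    - by rewrite /= size_rcons.
    - move: pth; rewrite -cat_rcons /= cat_path => /and3P[-> h _].
      by rewrite rcons_path h last_rcons c_sym.
  have uz : uniq [:: z, x, y & p].
    by rewrite cons_uniq up andbT !inE !negb_or zx zy zp.
  apply: (IH z x (y :: p)) => //; last by rewrite /= c_sym xz.
  have := max_card (mem [:: z, x, y & p]); rewrite (card_uniqP uz) /=.
  by move: hk => /=; lia.
exists p; split.
- apply: long_cycle_circuit => //; apply: sub_cycle cp; exact: c_adj.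
- move=> f /mapP[[a b] ab ->]; move: cp; rewrite cycle_zip_rot => /allP/(_ _ ab).
  by [].
- by rewrite -size_eq0 size_map size_zip size_rot minnn; case: (size p) sp.
Qed.

(** An even edge set is a disjoint union of circuits, and the join inequality adds up over them;
    circuits are removed one at a time. *)
Lemma join_even_edges J C : is_join adj J -> C \subset edges adj ->
  even_edges C -> (2 * #|J :&: C| <= #|C|)%N.
Proof.
move=> [_ hJ]; have [k] := ubnP #|C|; elim: k C => // k IH C Ck CE evC.
have [->|C0] := eqVneq C set0; first by rewrite setI0 cards0.
have [p [cp pC p0]] := even_edges_circuit CE evC C0.
pose D := [set f in closed_walk_edges p].
have DC : D \subset C by apply/subsetP => f; rewrite inE => /pC.
have hD : (2 * #|J :&: D| <= #|D|)%N.
  have /= := hJ p cp; rewrite -/D ler_pdivlMr ?ltr0n // -natrM ler_nat.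
  by rewrite mulnC.
have D_gt0 : (0 < #|D|)%N.
  case: (closed_walk_edges p) p0 @D {DC hD pC} => // f s _ D.
  by apply/card_gt0P; exists f; rewrite !inE eqxx.
have evD := circuit_even cp.
have cC : #|C| = (#|D| + #|C :\: D|)%N by rewrite -(cardsID D C) (setIidPr DC).
have evCD : even_edges (C :\: D).
  move=> v; have := evC v; have := evD v; rewrite -/D.
  rewrite -(cardsID D [set f in C | v \in f]).
  have -> : [set f in C | v \in f] :&: D = [set f in D | v \in f].
    apply/setP => f; have := subsetP DC f; rewrite !inE.
    by case: (f \in closed_walk_edges p) => [->|]; rewrite ?andbT ?andbF.
  have -> : [set f in C | v \in f] :\: D = [set f in C :\: D | v \in f].
    by apply/setP => f; rewrite !inE andbA.
  by rewrite oddD => /negPf->.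
have hCD : (2 * #|J :&: (C :\: D)| <= #|C :\: D|)%N.
  apply: IH => //; first by move: Ck; rewrite cC; lia.
  exact: subset_trans (subsetDl _ _) CE.
have -> : #|J :&: C| = (#|J :&: D| + #|J :&: (C :\: D)|)%N.
  by rewrite -(cardsID D (J :&: C)) -setIA (setIidPr DC) setIDA.
by rewrite cC; lia.
Qed.

(* The symmetric difference of J \ e and of the odd part of [m] is even, and
   the join inequality for it contradicts deg m = |J| - 1. *)
Lemma join_no_parity_match J (e : {set V}) (m : {set V} -> nat) :
    is_join adj J -> e \in edges adj -> (J != set0 -> e \in J) ->
    (\sum_(f in edges adj) m f)%N = #|J :\ e| ->
    (forall v, odd (\sum_(f in edges adj | v \in f) m f) =
               odd #|[set f in J :\ e | v \in f]|) ->
  m e = 0%N.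
Proof.
move=> hJ eE eJ sm odd_m; apply/eqP; rewrite -leqn0 leqNgt; apply/negP => me.
have JE : J \subset edges adj by case: hJ.
(* For empty J the total of [m] is 0, against [m e] > 0. *)
have {}eJ : e \in J.
  apply: eJ; apply: contraTneq me => J0; move: sm.
  rewrite J0 set0D cards0 (bigD1 e) //=; lia.
pose A := J :\ e; pose B := [set f in edges adj | odd (m f)].
pose C := (A :\: B) :|: (B :\: A).
have AE : A \subset edges adj by apply: subset_trans (subsetDl _ _) JE.
have BE : B \subset edges adj by apply/subsetP => f; rewrite inE => /andP[].
have CE : C \subset edges adj.
  by rewrite subUset !(subset_trans (subsetDl _ _)).
have card_sum (X : {set {set V}}) v : X \subset edges adj ->
    odd #|[set f in X | v \in f]| =
    \big[addb/false]_(f in edges adj | v \in f) (f \in X).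
  move=> XE; rewrite -sum1dep_card (big_morph odd oddD (erefl _)) /=.
  rewrite (big_mkcond (fun f => _ && _)) [RHS]big_mkcond; apply: eq_bigr => f _.
  have := subsetP XE f; case: (f \in X) => [->|_] //=.
  by rewrite if_same.
have evC : even_edges C.
  move=> v; rewrite card_sum //.
  have -> : \big[addb/false]_(f in edges adj | v \in f) (f \in C) =
            \big[addb/false]_(f in edges adj | v \in f) ((f \in A) (+) odd (m f)).
    apply: eq_bigr => f /andP[fE _]; rewrite !inE fE /=.
    by case: (f == e); case: (f \in J); case: (odd (m f)).
  by rewrite big_split /= -card_sum // -odd_m (big_morph odd oddD (erefl _)) addbb.
have hC := join_even_edges hJ CE evC.
have cC : #|C| = (#|A :\: B| + #|B :\: A|)%N.
  rewrite cardsU (_ : _ :&: _ = set0) ?cards0 ?subn0 //.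
  by apply/setP => f; rewrite !inE; case: (f \in J); case: (f == e); case: (odd _); rewrite ?andbF.
have cA := cardsID B A; have cB := cardsID A B; rewrite setIC in cB.
(* If e is in B, then J meets C in e besides A \ B, while |B| <= |A|. Otherwise [m e] is even,
   contributes nothing to B, and leaves |B| < |A|. Either way 2 |J :&: C| exceeds |C|. *)
have [eB|eB] := boolP (e \in B).
  have : (#|A :\: B| < #|J :&: C|)%N.
    have -> : (#|A :\: B|.+1 = #|e |: (A :\: B)|)%N by rewrite cardsU1 !inE eqxx andbF.
    apply: subset_leq_card; apply/subsetP => f; rewrite !in_setU1 !in_setI in_setU.
    case/orP => [/eqP->|fAB]; first by rewrite eJ [_ \in B :\: _]in_setD eB !inE eqxx orbT.
    by rewrite fAB andbT; move: fAB; rewrite !inE => /and3P[].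
  have : (#|B| <= #|A|)%N.
    rewrite -sm -sum1_card (big_mkcond (fun f => f \in B)) [leqRHS]big_mkcond.
    apply: leq_sum => f _; rewrite inE; case: (f \in _) => //=.
    by case: (m f) => //= k; case: ifP.
  by lia.
have : (#|B| + m e <= #|A|)%N.
  rewrite -sm (bigD1 e) //= addnC leq_add2l -sum1_card.
  rewrite (big_mkcond (fun f => f \in B)) [leqRHS]big_mkcond.
  apply: leq_sum => f _; case: ifP => // fB.
  have fe : f != e by apply: contraNneq eB => <-.
  by move: fB; rewrite inE => /andP[-> o] /=; rewrite fe; case: (m f) o.
have : (#|A :\: B| <= #|J :&: C|)%N.
  apply: subset_leq_card; apply/subsetP => f fAB; rewrite in_setI in_setU fAB andbT.
  by move: fAB; rewrite !inE => /and3P[].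
by lia.
Qed.

End Joins.
(** * The ideal of X_G *)

Section EdgeRing.
Variables (K : fieldType) (V : finType) (adj : rel V) (v0 : V).
Hypothesis adj_irr : irreflexive adj.
Local Notation E := (edges adj).
Local Notation S := {mpoly K[#|E|]}.

(** The exponent of the image of t^m under [theta]: the vertex degrees of the multigraph with edge
    multiplicities [m]. *)
Definition boundary (m : 'X_{1..#|E|}) : 'X_{1..#|V|} :=
  (\sum_(i < #|E|) (\sum_(v in enum_val i) U_(enum_rank v)) *+ m i)%MM.

Lemma theta_is_linear : linear (@theta K V adj).
Proof. by move=> c p q; rewrite /theta comp_mpolyD comp_mpolyZ. Qed.

HB.instance Definition _ := GRing.isLinear.Build K S {mpoly K[#|V|]} _
  (@theta K V adj) theta_is_linear.

Lemma thetaM (p q : S) : theta (p * q) = theta p * theta q.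
Proof. exact: rmorphM. Qed.

Lemma thetaX m : theta ('X_[m] : S) = 'X_[boundary m].
Proof.
rewrite /theta comp_mpolyX /boundary.
rewrite (big_morph (fun m => 'X_[m] : {mpoly K[#|V|]}) (@mpolyXD _ _) (@mpolyX0 _ _)).
apply: eq_bigr => i _; rewrite tnth_mktuple -mpolyXn; congr (_ ^+ _).
by rewrite (big_morph (fun m => 'X_[m] : {mpoly K[#|V|]}) (@mpolyXD _ _) (@mpolyX0 _ _)).
Qed.

Lemma boundaryE m (v : V) :
  boundary m (enum_rank v) = (\sum_(i < #|E| | v \in enum_val i) m i)%N.
Proof.
rewrite /boundary mnm_sumE [RHS]big_mkcond; apply: eq_bigr => i _.
rewrite mulmnE mnm_sumE (eq_bigr (fun u => (u == v : nat))); last first.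
  by move=> u _; rewrite mnm1E (inj_eq enum_rank_inj).
case: ifP => [vi|/negbT vi].
  by rewrite (bigD1 v) //= eqxx big1 ?mul1n // => u /andP[_ /negPf->].
by rewrite big1 // => u ui; case: eqP ui => // -> vi'; rewrite vi' in vi.
Qed.

Lemma card_edge f : f \in E -> #|f| = 2.
Proof. by case/edgesP=> x [y [xy ->]]; rewrite cards2 (adj_neq adj_irr xy). Qed.

Lemma mdeg_boundary m : mdeg (boundary m) = (2 * mdeg m)%N.
Proof.
rewrite /boundary mdeg_sum mdegE big_distrr; apply: eq_bigr => i _ /=.
rewrite mdegMn mdeg_sum (eq_bigr (fun=> 1%N)) => [|v _]; last exact: mdeg1.
by rewrite sum1_card card_edge ?enum_valP.
Qed.

Lemma IX_add p q : IX p -> IX q -> @IX K V adj (p + q).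
Proof. by rewrite /IX linearD; apply: generated_byD. Qed.

Lemma IX_mul p q : IX q -> @IX K V adj (p * q).
Proof. by rewrite /IX thetaM; apply: generated_byM. Qed.

Lemma IX_cancelX i p : IX ('X_i * p) -> @IX K V adj p.
Proof.
rewrite /IX thetaM; have -> : theta ('X_i : S) = \prod_(v in enum_val i) 'X_(enum_rank v).
  by rewrite /theta comp_mpolyXU -tnth_nth tnth_mktuple.
rewrite -big_enum; elim: (enum _) => [|v s IH]; first by rewrite big_nil mul1r.
by rewrite big_cons -mulrA => /(square_ideal_cancelX v0).
Qed.

Lemma IX_binomial a b : mdeg a = mdeg b ->
  (forall v, odd (boundary a (enum_rank v)) = odd (boundary b (enum_rank v))) ->
  IX ('X_[a] - 'X_[b] : S).
Proof.
move=> dab pab; apply/(square_idealE v0); rewrite !linearB /= !thetaX !normal_formX.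
rewrite (_ : normal_monomial _ (boundary a) = normal_monomial v0 (boundary b)) ?subrr //.
apply: normal_monomial_eq => [|i]; first by rewrite !mdeg_boundary dab.
by rewrite -(enum_valK i).
Qed.

Lemma normal_form_theta (p : S) : normal_form v0 (theta p) =
  \sum_(m <- msupp p) p@_m *: 'X_[normal_monomial v0 (boundary m)].
Proof.
rewrite [in LHS](mpolyE p) (linear_sum (@theta K V adj)) (linear_sum (normal_form v0)).
by apply: eq_bigr => m _; rewrite !linearZ /= thetaX normal_formX.
Qed.

(** The normal form of theta(t^a) is a single monomial, so some term of t_i g must have the same
    one; normal monomials remember degree and parities. *)
Lemma IX_match a i g : IX ('X_[a] - 'X_i * g : S) ->
  exists m : 'X_{1..#|E|}, [/\ (0 < m i)%N, mdeg m = mdeg a & forall v,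
    odd (boundary m (enum_rank v)) = odd (boundary a (enum_rank v))].
Proof.
move/(square_idealE v0); rewrite !linearB /= thetaX normal_formX => /eqP.
rewrite subr_eq0 => /eqP eq_nf; set c := normal_monomial v0 (boundary a) in eq_nf.
have [m mg mc] : exists2 m, m \in msupp ('X_i * g) & normal_monomial v0 (boundary m) = c.
  apply: contrapT => h; have /eqP := congr1 (mcoeff c) eq_nf.
  rewrite mcoeffX eqxx normal_form_theta raddf_sum big_seq big1 ?oner_eq0 //.
  move=> m mg; rewrite /= mcoeffZ mcoeffX.
  by case: eqP => [mc|_]; [case: h; exists m | rewrite mulr0].
have [dm pm] := normal_monomial_inj mc.
exists m; split=> //.
  move: mg; rewrite mulrC (perm_mem (msuppMX _ _)) => /mapP[m' _ ->].
  by rewrite mnmDE mnm1E eqxx.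
by move/eqP: dm; rewrite !mdeg_boundary eqn_pmul2l // => /eqP.
Qed.

(** By the pigeonhole principle some t_j^2 divides t^a, and t_j^2 can be traded for t_i^2. *)
Lemma high_degree_reducible i a : (#|E| < mdeg a)%N ->
  exists g, IX ('X_[a] - 'X_i * g : S).
Proof.
move=> ha; have [j aj] : exists j, (1 < a j)%N.
  apply/existsP; apply: contraTT ha; rewrite negb_exists -leqNgt => /forallP h.
  suff : (mdeg a <= \sum_(j < #|E|) 1)%N by rewrite sum1_card card_ord.
  rewrite mdegE; apply: leq_sum => j _.
  by rewrite leqNgt.
pose a' := (a - U_(j) *+ 2)%MM.
have ea : a = (U_(j) *+ 2 + a')%MM.
  rewrite addmC submK //; apply/mnm_lepP => k; rewrite mulmnE mnm1E.
  by case: eqP => // <-; rewrite mul1n.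
exists ('X_i * 'X_[a']); rewrite mulrA -expr2 mpolyXn -mpolyXD {1}ea.
apply: IX_binomial => [|v]; first by rewrite [LHS]mdegD [RHS]mdegD !mdegMn !mdeg1.
rewrite !boundaryE.
have oddE k : odd (\sum_(l < #|E| | v \in enum_val l) (U_(k) *+ 2 + a')%MM l) =
              odd (\sum_(l < #|E| | v \in enum_val l) a' l).
  rewrite !(big_morph odd oddD (erefl _)); apply: eq_bigr => l _.
  by rewrite mnmDE mulmnE oddD oddM andbF.
by rewrite !oddE.
Qed.

(** Multiply by variables as long as the class stays nonzero; the bound |E| on the degree stops
    this, at a socle element. *)
Lemma exists_socle_monomial i a : ~ (exists g, IX ('X_[a] - 'X_i * g : S)) ->
  exists b, [/\ (mdeg a <= mdeg b)%N, ~ (exists g, IX ('X_[b] - 'X_i * g : S)) &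
    forall j, exists g, IX ('X_j * 'X_[b] - 'X_i * g : S)].
Proof.
have [k] := ubnP (#|E|.+1 - mdeg a)%N; elim: k a => // k IH a ka ha.
have [h|/existsNP[j hj]] :=
    pselect (forall j, exists g, IX ('X_j * 'X_[a] - 'X_i * g : S)).
  by exists a.
have le_aE : (mdeg a <= #|E|)%N.
  by rewrite leqNgt; apply/negP => /(high_degree_reducible i).
rewrite -mpolyXD in hj.
have [|b [hab hb sb]] := IH (U_(j) + a)%MM _ hj; first by rewrite mdegD mdeg1; lia.
by exists b; split=> //; move: hab; rewrite mdegD mdeg1; lia.
Qed.

Lemma join_irreducible (J : {set {set V}}) (e : {set V}) (eE : e \in E)
    (a : 'X_{1..#|E|}) :
    ssrbool.symmetric adj -> is_join adj J -> (J != set0 -> e \in J) ->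
    (forall i, a i = (enum_val i \in J :\ e) :> nat) ->
  ~ (exists g, IX ('X_[a] - 'X_(enum_rank_in eE e) * g : S)).
Proof.
move=> adj_sym hJ eJ ha [g /IX_match[m [me dm pm]]].
(* [mu] reads the exponents as edge multiplicities; its default value off the edge set never enters
   the sums. *)
pose mu f := m (enum_rank_in eE f).
have mu_val i : mu (enum_val i) = m i by rewrite /mu enum_valK_in.
have JE : J :\ e \subset E by apply: subset_trans (subsetDl _ _) (proj1 hJ).
have sumJ (P : pred {set V}) :
    (\sum_(i < #|E| | P (enum_val i)) a i)%N = #|[set f in J :\ e | P f]|.
  rewrite (eq_bigr _ (fun i _ => ha i)) -(big_enum_val_cond P (fun f => f \in J :\ e : nat)).
  rewrite -sum1dep_card [RHS]big_mkcond [LHS]big_mkcond; apply: eq_bigr => f _.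
  by have := subsetP JE f; case: (f \in J :\ e) => [->|_] //=; rewrite if_same.
suff m0 : mu e = 0%N by rewrite /mu in m0; rewrite m0 in me.
apply: (join_no_parity_match adj_sym adj_irr hJ eE eJ) => [|v].
  rewrite big_enum_val (eq_bigr _ (fun i _ => mu_val i)) -mdegE dm mdegE.
  by rewrite (sumJ predT); apply: eq_card => f; rewrite inE andbT.
rewrite big_enum_val_cond (eq_bigr _ (fun i _ => mu_val i)) -boundaryE pm boundaryE.
by rewrite (sumJ (fun f => v \in f)).
Qed.

End EdgeRing.

(** * The lower bound for the regularity *)

Theorem theorem4p2 (K : fieldType) (V : finType) (adj : rel V)
    (adj_sym : ssrbool.symmetric adj) (adj_irr : irreflexive adj)
    (V_nonempty : (0 < #|V|)%N)
    (no_isolated : forall x, exists y, adj x y) :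
  forall r : int,
    is_reg_ideal (@IX K V adj) r ->
    (max_vertex_join_number adj)%:Z <= r.
Proof.
move=> r [F [resF _ reg_le]].
have [v0 _] : exists v, v \in V by apply/card_gt0P.
have [y v0y] := no_isolated v0.
suff le_r (J : {set {set V}}) : is_join adj J -> (#|J|%:Z <= r).
  (* The empty join rules out negative r, so the maximum can be compared in the natural numbers. *)
  have [r0|r_ge0] := ltP r 0.
    have j0 : is_join adj set0.
      by split=> [|p _ /=]; rewrite ?sub0set // set0I cards0 divr_ge0 ?ler0n.
    by have := le_lt_trans (le_r _ j0) r0; rewrite cards0 ltxx.
  rewrite -(gez0_abs r_ge0) lez_nat; apply/bigmax_leqP => J /asboolP /le_r.
  by rewrite -lez_nat gez0_abs.
move=> hJ.
(* For empty J any edge serves, and one exists because [v0] is not isolated. *)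
have [e [eE eJ]] : exists e, e \in edges adj /\ (J != set0 -> e \in J).
  have [->|/set0Pn[e eJ]] := eqVneq J set0.
    by exists [set v0; y]; rewrite set2_edges.
  by exists e; split=> //; apply: subsetP eJ; case: hJ.
pose a : 'X_{1..#|edges adj|} :=
  [multinom (enum_val i \in J :\ e : nat) | i < #|edges adj|].
have ha i : a i = (enum_val i \in J :\ e) by rewrite mnmE.
have da : mdeg a = #|J :\ e|.
  rewrite mdegE (eq_bigr _ (fun i _ => ha i)).
  rewrite -(big_enum_val (fun f => f \in J :\ e : nat)).
  rewrite -sum1_card [LHS]big_mkcond [RHS]big_mkcond; apply: eq_bigr => f _.
  have : f \in J :\ e -> f \in edges adj.
    by rewrite inE => /andP[_]; apply: subsetP; case: hJ.
  by case: (f \in J :\ e) => [->|_] //=; rewrite if_same.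
have [b [hab bI bX]] := exists_socle_monomial v0 adj_irr
  (join_irreducible (K := K) v0 adj_irr (eE := eE) adj_sym hJ eJ ha).
have [i [j [bij hij]]] := socle_betti resF (@IX_add K V adj) (@IX_mul K V adj)
  (@IX_cancelX K V adj v0 _) bI bX.
(* The chain is |J| - 1 <= mdeg a <= mdeg b <= j - i <= r - 1. *)
have := reg_le i j bij; have : (#|J| <= #|J :\ e|.+1)%N.
  by rewrite (cardsD1 e J); case: (e \in J).
by rewrite -da; lia.
Qed.
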